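(* Let $R$ be a right noetherian pro-$\pi$-regular ring. Then the topology on $R$ is the Jacobson topology, $R$ is strictly pro-right-artinian with respect to it, and any right ideal of $R$ is closed. In particular, $R$ is complete semilocal.
   Context: All rings are unital. A ring is $\pi$-regular if for every element $a$ the chain $aR\supseteq a^2R\supseteq a^3R\supseteq\cdots$ stabilizes. A topological ring is pro-$\pi$-regular if it is isomorphic, as a topological ring, to the inverse limit of an inverse system (indexed by a directed set) of discrete $\pi$-regular rings. It is strictly pro-right-artinian if it is isomorphic, as a topological ring, to the inverse limit of an inverse system of discrete right artinian rings such that the standard map from $R$ to each of these rings is onto. The Jacobson topology on $R$ is the ring topology with basis of neighborhoods of $0$ given by $\{\mathrm{Jac}(R)^n:n\in\mathbb{N}\}$, where $\mathrm{Jac}(R)$ is the Jacobson radical. $R$ is complete semilocal if $R/\mathrm{Jac}(R)$ is semisimple artinian and the natural map $R\to\varprojlim\{R/\mathrm{Jac}(R)^n\}_{n\in\mathbb{N}}$ is an isomorphism. *)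

(* Defs.v *)
From HB Require Import structures.
From mathcomp Require Import all_boot all_order all_algebra.
From mathcomp Require Import all_classical topology tvs.

Set Implicit Arguments.
Unset Strict Implicit.
Unset Printing Implicit Defensive.

Import GRing.Theory.
Local Open Scope classical_set_scope.
Local Open Scope ring_scope.

(* Rings are unital, possibly noncommutative, and may be zero: pzRingType. *)

HB.mixin Record TopologicalZmodule_isTopologicalPzRing R
    & TopologicalZmodule R & GRing.PzRing R := {
  mul_continuous : continuous (fun x : R * R => x.1 * x.2)
}.

#[short(type="topologicalPzRingType")]
HB.structure Definition TopologicalPzRing :=
  {R of TopologicalZmodule R & GRing.PzRing R
      & TopologicalZmodule_isTopologicalPzRing R}.

Section RightIdeals.
Variable R : pzRingType.
Implicit Types I J M : set R.

(* Stability under opposites follows by taking r = -1. *)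
Definition right_ideal I : Prop :=
  [/\ I 0, forall x y, I x -> I y -> I (x + y) & forall x r, I x -> I (x * r)].

Definition right_noetherian : Prop :=
  forall I : nat -> set R, (forall n, right_ideal (I n)) ->
    (forall n, I n `<=` I n.+1) ->
  exists N, forall n, (N <= n)%N -> I n = I N.

Definition right_artinian : Prop :=
  forall I : nat -> set R, (forall n, right_ideal (I n)) ->
    (forall n, I n.+1 `<=` I n) ->
  exists N, forall n, (N <= n)%N -> I n = I N.

Definition pi_regular : Prop :=
  forall a : R, exists N, forall n, (N <= n)%N ->
    range (fun r => a ^+ n * r) = range (fun r => a ^+ N * r).

Definition maximal_right_ideal M : Prop :=
  [/\ right_ideal M, M <> setT &
      forall I, right_ideal I -> M `<=` I -> I = M \/ I = setT].

(* The right module R is semisimple: every submodule is a direct summand. *)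
Definition semisimple : Prop :=
  forall I, right_ideal I -> exists J,
    [/\ right_ideal J, I `&` J = [set 0] &
        forall x, exists2 y, I y & exists2 z, J z & x = y + z].

End RightIdeals.

Arguments right_noetherian : clear implicits.
Arguments right_artinian : clear implicits.
Arguments pi_regular : clear implicits.
Arguments semisimple : clear implicits.

Record ideal (R : pzRingType) := Ideal {
  ideal_set :> set R;
  ideal_right : right_ideal ideal_set;
  ideal_left : forall r x, ideal_set x -> ideal_set (r * x)
}.

Section IdealQuotient.
Variables (R : pzRingType) (I : ideal R).

Definition ideal_pred : R -> bool := fun x => x \in (I : set R).

Lemma ideal_predP x : reflect (ideal_set I x) (x \in ideal_pred).
Proof. by rewrite unfold_in /ideal_pred; apply: (iffP idP); rewrite inE. Qed.

Lemma ideal_pred_zmod : zmod_closed ideal_pred.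
Proof.
have [I0 ID IM] := ideal_right I.
split; first exact/ideal_predP.
move=> x y /ideal_predP Ix /ideal_predP Iy; apply/ideal_predP.
by apply: ID => //; rewrite -mulrN1; apply: IM.
Qed.

HB.instance Definition _ := GRing.isZmodClosed.Build R ideal_pred ideal_pred_zmod.

Definition ideal_zmod : zmodClosed R := GRing.ZmodClosed.clone R ideal_pred _.

Definition ideal_quot : Type := Quotient.quot ideal_zmod.

HB.instance Definition _ := GRing.Zmodule.on ideal_quot.
HB.instance Definition _ := Quotient.on ideal_quot.

Definition quot_proj (x : R) : ideal_quot := (\pi_ideal_quot x)%qT.

Lemma quot_projE x y : quot_proj x = quot_proj y <-> ideal_set I (x - y).
Proof.
split=> [/eqP|h]; first by rewrite -Quotient.idealrBE => /ideal_predP.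
by apply/eqP; rewrite -Quotient.idealrBE; apply/ideal_predP.
Qed.

Lemma quot_projK (x : ideal_quot) : quot_proj (repr x) = x.
Proof. exact: reprK. Qed.

Lemma quot_projD x y : quot_proj (x + y) = quot_proj x + quot_proj y.
Proof. exact: (@pi_addr _ _ _ _ _ (Quotient.quot ideal_zmod)). Qed.

Definition quot_one : ideal_quot := quot_proj 1.
Definition quot_mul (x y : ideal_quot) : ideal_quot :=
  quot_proj (repr x * repr y).

Lemma quot_projM x y : quot_proj (x * y) = quot_mul (quot_proj x) (quot_proj y).
Proof.
apply/quot_projE; have [I0 ID IM] := ideal_right I.
set x' := repr _; set y' := repr _.
have hx : ideal_set I (x - x') by apply/quot_projE; rewrite quot_projK.
have hy : ideal_set I (y - y') by apply/quot_projE; rewrite quot_projK.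
rewrite -(addrNK (x' * y) (x * y)) -mulrBl -addrA -mulrBr.
by apply: ID; [exact: IM|exact: ideal_left].
Qed.

Lemma quot_mulA : associative quot_mul.
Proof.
move=> x y z; rewrite -(quot_projK x) -(quot_projK y) -(quot_projK z).
by rewrite -!quot_projM mulrA.
Qed.

Lemma quot_mul1 : left_id quot_one quot_mul.
Proof. by move=> x; rewrite -(quot_projK x) -quot_projM mul1r. Qed.

Lemma quot_1mul : right_id quot_one quot_mul.
Proof. by move=> x; rewrite -(quot_projK x) -quot_projM mulr1. Qed.

Lemma quot_mulDl : left_distributive quot_mul +%R.
Proof.
move=> x y z; rewrite -(quot_projK x) -(quot_projK y) -(quot_projK z).
by rewrite -quot_projD -!quot_projM -quot_projD mulrDl.
Qed.

Lemma quot_mulDr : right_distributive quot_mul +%R.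
Proof.
move=> x y z; rewrite -(quot_projK x) -(quot_projK y) -(quot_projK z).
by rewrite -quot_projD -!quot_projM -quot_projD mulrDr.
Qed.

HB.instance Definition _ := GRing.Zmodule_isPzRing.Build ideal_quot
  quot_mulA quot_mul1 quot_1mul quot_mulDl quot_mulDr.

Lemma quot_projB x y : quot_proj (x - y) = quot_proj x - quot_proj y.
Proof. by apply: (addIr (quot_proj y)); rewrite -quot_projD !subrK. Qed.

HB.instance Definition _ := GRing.isZmodMorphism.Build R ideal_quot quot_proj
  quot_projB.
HB.instance Definition _ := GRing.isMonoidMorphism.Build R ideal_quot quot_proj
  (erefl, quot_projM).

End IdealQuotient.

(* The canonical map R / J -> R / I for ideals J `<=` I. *)
Section QuotientMap.
Variables (R : pzRingType) (I J : ideal R).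

Definition quot_map (_ : J `<=` I) : ideal_quot J -> ideal_quot I :=
  fun x => quot_proj I (repr x).

Variable JI : J `<=` I.

Lemma quot_mapE x : quot_map JI (quot_proj J x) = quot_proj I x.
Proof. by apply/quot_projE; apply: JI; apply/quot_projE; rewrite quot_projK. Qed.

Lemma quot_map_zmod : zmod_morphism (quot_map JI).
Proof.
move=> x y; rewrite -(quot_projK x) -(quot_projK y).
by rewrite -rmorphB !quot_mapE rmorphB.
Qed.

Lemma quot_map_monoid : monoid_morphism (quot_map JI).
Proof.
split; first by rewrite -(rmorph1 (quot_proj J)) quot_mapE rmorph1.
move=> x y; rewrite -(quot_projK x) -(quot_projK y).
by rewrite -rmorphM !quot_mapE rmorphM.
Qed.

HB.instance Definition _ := GRing.isZmodMorphism.Build _ _ (quot_map JI)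
  quot_map_zmod.
HB.instance Definition _ := GRing.isMonoidMorphism.Build _ _ (quot_map JI)
  quot_map_monoid.

End QuotientMap.

Section Jacobson.
Variable R : pzRingType.
Implicit Types I J : ideal R.

Definition jacobson_set : set R :=
  \bigcap_(M in [set M : set R | maximal_right_ideal M]) M.

Lemma jacobson_right : right_ideal jacobson_set.
Proof.
split=> [M [[]]//|x y Jx Jy M mM|x r Jx M mM]; have [[M0 MD MM] _ _] := mM.
  by apply: MD; [exact: Jx|exact: Jy].
by apply: MM; exact: Jx.
Qed.

Lemma jacobson_left r x : jacobson_set x -> jacobson_set (r * x).
Proof.
move=> Jx M mM; have [[M0 MD MM] Mproper Mmax] := mM.
pose K := [set y : R | M (r * y)].
have rK : right_ideal K.
  split=> [|y z Ky Kz|y s Ky]; first by rewrite /K /= mulr0.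
    by rewrite /K /= mulrDr; exact: MD.
  by rewrite /K /= mulrA; exact: MM.
have [K1|K1] := pselect (K 1); first by rewrite -(mul1r x) mulrA; exact: MM.
apply: (Jx K); split=> // [KT|N [N0 ND NM] KN]; first by apply: K1; rewrite KT.
have [NK|] := pselect (N `<=` K); first by left; apply/seteqP.
move=> /existsNP[y] /not_implyP[Ny nKy]; right.
pose P := [set z : R | exists2 m, M m & exists s, z = m + r * y * s].
have rP : right_ideal P.
  split=> [|_ _ [m Mm [s ->]] [m' Mm' [s' ->]]|_ t [m Mm [s ->]]].
  - by exists 0 => //; exists 0; rewrite mulr0 addr0.
  - exists (m + m'); first exact: MD.
    by exists (s + s'); rewrite mulrDr addrACA.
  - exists (m * t); first exact: MM.
    by exists (s * t); rewrite mulrDl !mulrA.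
have MP : M `<=` P by move=> m Mm; exists m => //; exists 0; rewrite mulr0 addr0.
have [PM|PT] := Mmax P rP MP.
  case: nKy; rewrite /K /= -PM; exists 0 => //.
  by exists 1; rewrite add0r mulr1.
have [m Mm [s rE]] : P r by rewrite PT.
have K1ys : K (1 - y * s).
  by rewrite /K /= mulrBr mulr1 {1}rE mulrA addrK.
have N1 : N 1 by rewrite -(subrK (y * s) 1); apply: ND; [exact: KN|exact: NM].
by apply/seteqP; split=> // z _; rewrite -(mul1r z); exact: NM.
Qed.

Definition jacobson : ideal R := Ideal jacobson_right jacobson_left.

(* Finite sums of products a * b with a in I and b in J. *)
Definition ideal_mul_set I J : set R :=
  [set x | exists2 s : seq (R * R), (forall p, p \in s -> ideal_set I p.1 /\ ideal_set J p.2)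
                                  & x = \sum_(p <- s) p.1 * p.2].

Lemma ideal_mul_right I J : right_ideal (ideal_mul_set I J).
Proof.
have [J0 JD JM] := ideal_right J.
split=> [|_ _ [s sP ->] [t tP ->]|_ r [s sP ->]].
- by exists [::] => //; rewrite big_nil.
- exists (s ++ t); last by rewrite big_cat.
  by move=> p; rewrite mem_cat => /orP[/sP|/tP].
- exists [seq (p.1, p.2 * r) | p <- s].
    by move=> _ /mapP[p /sP[Ip Jp] ->]; split=> //=; exact: JM.
  by rewrite big_map mulr_suml; apply: eq_bigr => p _; rewrite mulrA.
Qed.

Lemma ideal_mul_left I J r x : ideal_mul_set I J x -> ideal_mul_set I J (r * x).
Proof.
move=> [s sP ->]; exists [seq (r * p.1, p.2) | p <- s].
  by move=> _ /mapP[p /sP[Ip Jp] ->]; split=> //=; exact: ideal_left.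
by rewrite big_map mulr_sumr; apply: eq_bigr => p _; rewrite mulrA.
Qed.

Definition ideal_mul I J : ideal R :=
  Ideal (ideal_mul_right I J) (@ideal_mul_left I J).

Lemma idealT_right : right_ideal [set: R].
Proof. by []. Qed.

Definition idealT : ideal R := Ideal idealT_right (fun _ _ _ => I).

Definition ideal_exp I n : ideal R := iter n (ideal_mul I) idealT.

Lemma ideal_exp_le I m n : (m <= n)%N -> ideal_exp I n `<=` ideal_exp I m.
Proof.
elim: m n => [//|m IHm] [//|n] mn _ [s sP ->]; exists s => // p /sP[Ip Ep].
by split=> //; exact: IHm Ep.
Qed.

End Jacobson.

Arguments jacobson_set : clear implicits.
Arguments jacobson : clear implicits.

(* Inverse systems of discrete rings; the objects carry no topology here and are
   made discrete in discrete_prod. *)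
Record inverse_system := InverseSystem {
  inv_index : Type;
  inv_le : inv_index -> inv_index -> Prop;
  inv_obj :> inv_index -> pzRingType;
  inv_map : forall i j, inv_le i j -> {rmorphism inv_obj j -> inv_obj i};
  inv_inhabited : exists i : inv_index, True;
  inv_le_refl : forall i, inv_le i i;
  inv_le_trans : forall i j k, inv_le i j -> inv_le j k -> inv_le i k;
  inv_directed : forall i j, exists k, inv_le i k /\ inv_le j k;
  inv_map_id : forall i (ii : inv_le i i) x, inv_map ii x = x;
  inv_map_comp : forall i j k (ij : inv_le i j) (jk : inv_le j k)
    (ik : inv_le i k) x, inv_map ij (inv_map jk x) = inv_map ik x
}.

Section DiscreteProduct.
Variables (I : Type) (A : I -> pzRingType).

Definition discrete_prod : Type :=
  prod_topology (fun i => discrete_topology (A i)).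

HB.instance Definition _ := Topological.on discrete_prod.

Implicit Types f g : discrete_prod.

Let zero : discrete_prod := fun i => 0 : A i.
Let opp f : discrete_prod := fun i => - (f i : A i).
Let add f g : discrete_prod := fun i => (f i : A i) + (g i : A i).
Let one : discrete_prod := fun i => 1 : A i.
Let mul f g : discrete_prod := fun i => (f i : A i) * (g i : A i).

Let addA : associative add.
Proof. by move=> f g h; apply: functional_extensionality_dep => i; exact: addrA. Qed.
Let addC : commutative add.
Proof. by move=> f g; apply: functional_extensionality_dep => i; exact: addrC. Qed.
Let add0 : left_id zero add.
Proof. by move=> f; apply: functional_extensionality_dep => i; exact: add0r. Qed.
Let addN : left_inverse zero opp add.
Proof. by move=> f; apply: functional_extensionality_dep => i; exact: addNr. Qed.
Let mulA : associative mul.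
Proof. by move=> f g h; apply: functional_extensionality_dep => i; exact: mulrA. Qed.
Let mul1 : left_id one mul.
Proof. by move=> f; apply: functional_extensionality_dep => i; exact: mul1r. Qed.
Let m1ul : right_id one mul.
Proof. by move=> f; apply: functional_extensionality_dep => i; exact: mulr1. Qed.
Let mulDl : left_distributive mul add.
Proof. by move=> f g h; apply: functional_extensionality_dep => i; exact: mulrDl. Qed.
Let mulDr : right_distributive mul add.
Proof. by move=> f g h; apply: functional_extensionality_dep => i; exact: mulrDr. Qed.

HB.instance Definition _ := GRing.isZmodule.Build discrete_prod addA addC add0 addN.
HB.instance Definition _ := GRing.Zmodule_isPzRing.Build discrete_prod
  mulA mul1 m1ul mulDl mulDr.

End DiscreteProduct.

Section InverseLimit.
Variable S : inverse_system.

Definition compatible : {pred discrete_prod S} := fun f =>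
  `[< forall i j (ij : inv_le i j), inv_map ij (f j) = f i >].

Lemma compatibleP (f : discrete_prod S) :
  reflect (forall i j (ij : inv_le i j), inv_map ij (f j) = f i)
          (f \in compatible).
Proof. exact: asboolP. Qed.

Lemma compatible_subring : subring_closed compatible.
Proof.
split=> [|f g /compatibleP cf /compatibleP cg|f g /compatibleP cf /compatibleP cg];
  apply/compatibleP => i j ij.
- exact: rmorph1.
- by rewrite -[RHS]/((f i : S i) - g i) -(cf _ _ ij) -(cg _ _ ij) -rmorphB.
- by rewrite -[RHS]/((f i : S i) * g i) -(cf _ _ ij) -(cg _ _ ij) -rmorphM.
Qed.

Record inv_lim : Type := InvLim {
  inv_lim_val :> discrete_prod S;
  inv_lim_compatible : inv_lim_val \in compatible
}.

HB.instance Definition _ := [isSub for inv_lim_val].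
HB.instance Definition _ := [Choice of inv_lim by <:].
HB.instance Definition _ := GRing.SubChoice_isSubPzRing.Build _ compatible
  inv_lim compatible_subring.
HB.instance Definition _ := Topological.copy inv_lim (initial_topology inv_lim_val).

Definition inv_lim_proj (i : inv_index S) (x : inv_lim) : S i := inv_lim_val x i.

Lemma inv_lim_projB i x y :
  inv_lim_proj i (x - y) = inv_lim_proj i x - inv_lim_proj i y.
Proof. by rewrite /inv_lim_proj -[inv_lim_val]/val rmorphB. Qed.

Lemma inv_lim_projM i x y :
  inv_lim_proj i (x * y) = inv_lim_proj i x * inv_lim_proj i y.
Proof. by rewrite /inv_lim_proj -[inv_lim_val]/val rmorphM. Qed.

Lemma inv_lim_proj_continuous i :
  continuous (inv_lim_proj i : inv_lim -> discrete_topology (S i)).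
Proof.
move=> x; apply: (@continuous_comp _ _ _ inv_lim_val
  (fun f : discrete_prod S => f i)); first exact: initial_continuous.
move=> U fU; have /cvg_sup/(_ i) h := @cvg_id _ (nbhs (inv_lim_val x)).
pose p (f : discrete_prod S) : discrete_topology (S i) := f i.
exact: (h _ (@initial_continuous _ _ p (inv_lim_val x) U fU)).
Qed.

Lemma inv_lim_proj_nbhs i (x : inv_lim) :
  \forall y \near x, inv_lim_proj i y = inv_lim_proj i x.
Proof.
apply: (@inv_lim_proj_continuous i x [set inv_lim_proj i x]).
exact: (@discrete_set1 (discrete_topology (S i))).
Qed.

Lemma inv_lim_cvg (T : Type) (F : set_system T) (FF : Filter F)
    (f : T -> inv_lim) (x : inv_lim) :
  (forall i, \forall t \near F, inv_lim_proj i (f t) = inv_lim_proj i x) ->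
  f @ F --> x.
Proof.
move=> fx; suff : (inv_lim_val \o f) @ F --> inv_lim_val x.
  move=> h U [_ [[V oV <-] Vx] VU]; apply: filterS VU _.
  by apply: h; exact: open_nbhs_nbhs.
apply/cvg_sup => i U [_ [[V oV <-] Vx] VU]; apply: filterS (fx i) => t fxt.
by apply: VU; rewrite /preimage /= -[inv_lim_val _ i]/(inv_lim_proj i _) fxt.
Qed.

Lemma inv_lim_sub_continuous : continuous (fun x : inv_lim * inv_lim => x.1 - x.2).
Proof.
move=> [x y]; apply: inv_lim_cvg => i.
exists ([set z | inv_lim_proj i z = inv_lim_proj i x],
        [set z | inv_lim_proj i z = inv_lim_proj i y]).
  by split; exact: inv_lim_proj_nbhs.
move=> [u v] [/= ux vy]; apply: (etrans (inv_lim_projB i u v)).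
by rewrite ux vy -inv_lim_projB.
Qed.

Lemma inv_lim_mul_continuous : continuous (fun x : inv_lim * inv_lim => x.1 * x.2).
Proof.
move=> [x y]; apply: inv_lim_cvg => i.
exists ([set z | inv_lim_proj i z = inv_lim_proj i x],
        [set z | inv_lim_proj i z = inv_lim_proj i y]).
  by split; exact: inv_lim_proj_nbhs.
move=> [u v] [/= ux vy]; apply: (etrans (inv_lim_projM i u v)).
by rewrite ux vy -inv_lim_projM.
Qed.

HB.instance Definition _ := PreTopologicalNmodule_isTopologicalZmodule.Build
  inv_lim inv_lim_sub_continuous.
HB.instance Definition _ := TopologicalZmodule_isTopologicalPzRing.Build
  inv_lim inv_lim_mul_continuous.

End InverseLimit.

Arguments compatible : clear implicits.

Section Pro.
Implicit Types (P : pzRingType -> Prop) (R : topologicalPzRingType).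

Definition topological_ring_iso R R' (f : {rmorphism R -> R'}) : Prop :=
  continuous f /\ exists g : R' -> R, [/\ cancel f g, cancel g f & continuous g].

(* R is isomorphic, as a topological ring, to the limit of an inverse system of
   discrete rings satisfying P. *)
Definition pro P R : Prop :=
  exists (S : inverse_system) (f : {rmorphism R -> inv_lim S}),
    topological_ring_iso f /\ forall i, P (S i).

Definition strictly_pro P R : Prop :=
  exists (S : inverse_system) (f : {rmorphism R -> inv_lim S}),
    [/\ topological_ring_iso f, forall i, P (S i) &
        forall i (y : S i), exists x : R, inv_lim_proj i (f x) = y].

Definition has_jacobson_topology R : Prop :=
  nbhs (0 : R) =
  filter_from [set: nat] (fun n => ideal_set (ideal_exp (jacobson R) n)).

End Pro.

Section CompleteSemilocal.
Variable R : pzRingType.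

Let J n := ideal_exp (jacobson R) n.

Let J_obj n : pzRingType := ideal_quot (J n).

Let J_map m n (mn : (m <= n)%N) : {rmorphism J_obj n -> J_obj m} :=
  quot_map (@ideal_exp_le R (jacobson R) m n mn).

Lemma jacobson_map_id n (nn : (n <= n)%N) x : J_map nn x = x.
Proof. by rewrite -(quot_projK x) /= quot_mapE. Qed.

Lemma jacobson_map_comp m n p (mn : (m <= n)%N) (np : (n <= p)%N)
  (mp : (m <= p)%N) x : J_map mn (J_map np x) = J_map mp x.
Proof. by rewrite -(quot_projK x) /= !quot_mapE. Qed.

Lemma leq_directed (m n : nat) : exists p, (m <= p)%N /\ (n <= p)%N.
Proof. by exists (maxn m n); rewrite leq_maxl leq_maxr. Qed.

Definition jacobson_system : inverse_system := @InverseSystem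
  nat (fun m n => (m <= n)%N) J_obj J_map (ex_intro _ 0%N I) leqnn
  (fun j i k => @leq_trans i j k) leq_directed jacobson_map_id jacobson_map_comp.

Lemma jacobson_system_compatible x :
  ((fun n => quot_proj (J n) x) : discrete_prod jacobson_system)
    \in compatible jacobson_system.
Proof. by apply/compatibleP => m n mn; rewrite /= quot_mapE. Qed.

Definition jacobson_completion (x : R) : inv_lim jacobson_system :=
  InvLim (jacobson_system_compatible x).

Lemma jacobson_completion_zmod : zmod_morphism jacobson_completion.
Proof.
move=> x y; apply: val_inj; apply: functional_extensionality_dep => n.
exact: rmorphB.
Qed.

Lemma jacobson_completion_monoid : monoid_morphism jacobson_completion.
Proof.
split=> [|x y]; apply: val_inj; apply: functional_extensionality_dep => n.
  exact: rmorph1.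
exact: rmorphM.
Qed.

HB.instance Definition _ := GRing.isZmodMorphism.Build _ _ jacobson_completion
  jacobson_completion_zmod.
HB.instance Definition _ := GRing.isMonoidMorphism.Build _ _ jacobson_completion
  jacobson_completion_monoid.

Definition complete_semilocal : Prop :=
  [/\ semisimple (ideal_quot (jacobson R)),
      right_artinian (ideal_quot (jacobson R)) &
      bijective jacobson_completion].

End CompleteSemilocal.

Arguments complete_semilocal : clear implicits.

(* Main.v *)
(* The kernels K_i of the projections of R form a basis of ideals at 0, and R is
   complete for them.  In a pi-regular ring every element has a Drazin inverse
   (Dischinger's theorem); Drazin inverses are unique, hence compatible with the
   transition maps, so every a in R has one modulo all the K_i.  It follows that a
   right ideal outside J = Jac(R) contains an idempotent outside J, and that J is
   nil modulo each K_i.  With R right noetherian the former makes R/J semisimple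
   artinian, hence every R/J^n right artinian, and the latter gives J^n <= K_i for
   some n, by Levitzki's theorem.  As R/J^n is artinian, the closure of J^n is of the
   form J^n + K_i, hence open: R is first countable, and a Mittag-Leffler argument on a
   right ideal I filtered by the I J^k, which have artinian quotients I / I J^k, shows
   that I is closed.  In particular J^n is closed, hence open. *)
From HB Require Import structures.
Require Import Defs.
From mathcomp Require Import all_boot all_order all_algebra.
From mathcomp Require Import all_classical topology tvs.

Set Implicit Arguments.
Unset Strict Implicit.
Unset Printing Implicit Defensive.

Import GRing.Theory.
Local Open Scope classical_set_scope.
Local Open Scope ring_scope.

(** * Drazin inverses in pi-regular rings *)

Section DrazinInverse.
Variable S : pzRingType.
Implicit Types a b c d g x y : S.

Definition drazin_inverse a x : Prop := a * x = x * a /\ x * a * x = x.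

(** Substituting the relation repeatedly for the rightmost factor [a] gives
    [a = a ^+ j.+1 * b ^+ j], which keeps the powers sorted without commuting [a] and [b]. *)
Lemma exp_right_regular a b k : a = a * a * b -> a ^+ k = a ^+ k * a ^+ k * b ^+ k.
Proof.
move=> aE; have absorb j : a = a ^+ j.+1 * b ^+ j.
  elim: j => [|j IHj]; first by rewrite expr1 expr0 mulr1.
  by rewrite [b ^+ _]exprS mulrA exprSr exprSr -!mulrA (mulrA a) (mulrA (a * a))
    -aE mulrA -exprSr -IHj.
case: k => [|k]; first by rewrite !expr0 !mulr1.
rewrite [LHS]exprSr {2}(absorb k.+1) mulrA -exprD.
by rewrite -[in RHS]exprD addSnnS.
Qed.

(* Dischinger's theorem for a single element.  The relations give a c = a^2, hence
   a d = 0, b^2 d^2 = b d and a b d^2 = 0; the regularity of d then forces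
   a b d = a b^2 d = 0. *)
Lemma dischinger a b c d y k :
  a = a * a * b -> b = b * b * c -> d = c - a -> d ^+ k.+1 = d ^+ k.+2 * y ->
  a = a * b * b * a * a.
Proof.
move=> aE bE dE dk.
have abc : a * b * c = a.
  by rewrite {1}aE -!mulrA (mulrA b b c) -bE mulrA -aE.
have ad : a * d = 0.
  by rewrite dE mulrBr {1}aE -!mulrA (mulrA a b) abc subrr.
have bd2 : b * b * d * d = b * d.
  by rewrite {1}dE mulrBr -bE mulrBl -(mulrA _ a) ad mulr0 subr0.
have abd2 : a * b * d * d = 0.
  by rewrite {1}dE mulrBr abc mulrBl ad -(mulrA _ a) ad mulr0 subr0.
have bdn n : b ^+ n.+1 * d ^+ n.+1 = b * d.
  elim: n => [//|n IHn].
  by rewrite exprSr [d ^+ _]exprS -IHn exprSr exprS -!mulrA; congr (_ * _);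
    rewrite !mulrA bd2.
have bdy : b * d * d * y = b * d.
  by rewrite -{1}(bdn k) -(mulrA _ _ d) -exprSr -mulrA -dk bdn.
have abd : a * b * d = 0.
  by rewrite -mulrA -bdy !mulrA abd2 mul0r.
have abbd : a * b * b * d = 0.
  by rewrite -!mulrA -bdy !mulrA -(mulrA a b b) -(mulrA a (b * b)) -(mulrA a) bd2
    !mulrA abd mul0r.
have abE : a * b = a * b * b * a.
  by rewrite {1}bE !mulrA -[in LHS](subrK a c) -dE mulrDr abbd add0r.
by rewrite -abE; apply/eqP; rewrite -{1}abc -subr_eq0 -mulrBr -dE abd.
Qed.

Lemma pi_regularP a : pi_regular S ->
  exists n b, a ^+ n.+1 = a ^+ n.+1 * a ^+ n.+1 * b.
Proof.
move=> /(_ a)[N aN].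
have [b _ bE] : range (fun r => a ^+ (N.+1 + N.+1) * r) (a ^+ N.+1).
  rewrite aN; last by rewrite addSn ltnW// ltnS leq_addr.
  by rewrite -(aN N.+1)//; exists 1; rewrite ?mulr1.
by exists N, b; rewrite -exprD bE.
Qed.

(** The chain condition is one-sided; [dischinger] supplies the left relation. It is applied to a
    common power of [a ^+ n.+1] and [b], high enough for [b] to satisfy a relation of the same
    kind. *)
Lemma strongly_pi_regular a : pi_regular S ->
  exists n b y, a ^+ n.+1 = a ^+ n.+1 * a ^+ n.+1 * b /\
                a ^+ n.+1 = y * a ^+ n.+1 * a ^+ n.+1.
Proof.
move=> piS; have [n [b aE]] := pi_regularP a piS.
have [k [c bE]] := pi_regularP b piS.
have {}aE := exp_right_regular k.+1 aE.
have [l [y dE]] := pi_regularP (c - a ^+ n.+1 ^+ k.+1) piS.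
(* The successor of this exponent is [n.+1 * k.+1]; the left multiplier is read off from the
   conclusion of [dischinger]. *)
exists (n + k * n.+1)%N, (b ^+ k.+1), (a ^+ n.+1 ^+ k.+1 * b ^+ k.+1 * b ^+ k.+1).
have -> : (n + k * n.+1).+1 = (n.+1 * k.+1)%N by rewrite -addSn -mulSn mulnC.
rewrite exprM; split=> //.
apply: (@dischinger _ _ c _ ((c - a ^+ n.+1 ^+ k.+1) ^+ l * y) l) => //.
by rewrite mulrA -exprD addSnnS exprD -dE.
Qed.

(** With [p = a ^+ m.+1], the element [e = p * b = y * p] is idempotent and [g] inverts [p] in the
    corner ring eSe. As [a] commutes with [p], it commutes with [e] and [g], so [a ^+ m * g] is the
    Drazin inverse. *)
Lemma drazin_inverse_exists a : pi_regular S ->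
  exists2 x, drazin_inverse a x & exists n, a ^+ n * (1 - a * x) = 0.
Proof.
move=> /(strongly_pi_regular a)[m [b [y []]]]; set p := a ^+ m.+1 => pb py.
pose e := p * b; pose g := e * b.
have eE : e = y * p by rewrite /e {1}py -!mulrA (mulrA p) -pb.
have pe : p * e = p by rewrite /e mulrA -pb.
have ep : e * p = p by rewrite eE -py.
have ee : e * e = e by rewrite {1}eE /e mulrA -py.
have pg : p * g = e by rewrite /g mulrA pe.
have gp : g * p = e by rewrite /g eE -(mulrA y) -/e -mulrA ep.
have eg : e * g = g by rewrite /g mulrA ee.
have ge : g * e = g by rewrite -pg mulrA gp eg.
clearbody g e.
have ap : a * p = p * a by rewrite -exprS -exprSr.
have ae : a * e = e * a.
  have <- : e * a * e = a * e.
    by rewrite -{2}pg mulrA -(mulrA e) ap mulrA ep -ap -mulrA pg.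
  by rewrite -{1}gp -(mulrA g) -ap -!mulrA pe ap mulrA gp.
have ag : a * g = g * a.
  by rewrite -{2}ge -mulrA -ae -pg (mulrA a) ap !mulrA gp -ae -mulrA eg.
have apow k : a ^+ k * g = g * a ^+ k.
  by elim: k => [|k IHk]; rewrite ?expr0 ?mulr1 ?mul1r// exprS -mulrA IHk mulrA ag
    -mulrA.
exists (a ^+ m * g); last first.
  by exists m.+1; rewrite mulrA -exprS -/p pg mulrBr mulr1 pe subrr.
rewrite /drazin_inverse mulrA -exprS -/p pg; split.
  by rewrite -mulrA -ag mulrA -exprSr -/p pg.
by rewrite -mulrA (mulrA a) -exprS -/p pg -mulrA ge.
Qed.

Lemma drazin_absorb a x k : drazin_inverse a x -> x = x ^+ k.+1 * a ^+ k.
Proof.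
move=> [ax xax]; elim: k => [|k IHk]; first by rewrite mulr1.
rewrite [LHS]IHk [a ^+ k.+1]exprS mulrA; congr (_ * _).
by rewrite [x ^+ k.+2]exprSr -mulrA -ax !exprSr -!mulrA (mulrA x) xax.
Qed.

(** Both [a * x] and [a * x'] fix [a ^+ (m + n)] under right multiplication. Absorbing this power
    into [x] gives [x = x * a * x']; absorbing it into [x'] gives the same value. *)
Lemma drazin_inverse_unique a x x' n m :
  drazin_inverse a x -> a ^+ n * (1 - a * x) = 0 ->
  drazin_inverse a x' -> a ^+ m * (1 - a * x') = 0 -> x = x'.
Proof.
move=> dx an dx' am; have [ax xax] := dx; have [ax' _] := dx'.
have aN : a ^+ (m + n) = a ^+ (m + n) * (a * x).
  by apply/eqP; rewrite -subr_eq0 -{1}(mulr1 (a ^+ _)) -mulrBr exprD -mulrA an mulr0.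
have aM : a ^+ (m + n) = a ^+ (m + n) * (a * x').
  apply/eqP; rewrite -subr_eq0 -{1}(mulr1 (a ^+ _)) -mulrBr addnC exprD -mulrA am.
  by rewrite mulr0.
have xE : x = x * a * x'.
  by rewrite {1}(drazin_absorb (m + n) dx) aM mulrA -(drazin_absorb _ dx) mulrA.
have ca : GRing.comm (a ^+ (m + n)) (a * x).
  apply/commr_sym/commrX/commr_sym/commrM; first exact: commr_refl.
  exact: ax.
have ca' : GRing.comm (x' ^+ (m + n).+1) (a ^+ (m + n)).
  by apply: commrX; apply/commr_sym/commrX/commr_sym.
rewrite xE -ax [RHS](drazin_absorb (m + n) dx') ca' aN ca -[RHS]mulrA -ca'.
by rewrite -(drazin_absorb _ dx').
Qed.

End DrazinInverse.

(** * Chain conditions on right ideals *)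

Section ChainConditions.
Variable R : pzRingType.
Implicit Types (A B C I L M : set R) (D : nat -> set R) (a x y r : R).

Definition rsum A B : set R := [set x | exists2 a, A a & exists2 b, B b & x = a + b].

Definition rprincipal a : set R := range (fun r => a * r).

(** For right ideals [A] inside [B], this says that the right module B/A is artinian, without
    forming quotient modules. *)
Definition dcc_between A B : Prop :=
  forall D, (forall n, right_ideal (D n)) -> (forall n, D n.+1 `<=` D n) ->
    (forall n, A `<=` D n) -> (forall n, D n `<=` B) ->
  exists N, forall n, (N <= n)%N -> D n = D N.

Lemma right_idealB I x y : right_ideal I -> I x -> I y -> I (x - y).
Proof. by move=> [_ ID IM] Ix Iy; apply: ID => //; rewrite -mulrN1; exact: IM. Qed.

Lemma right_idealI I L : right_ideal I -> right_ideal L -> right_ideal (I `&` L).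
Proof.
move=> [I0 ID IM] [L0 LD LM]; split=> [//|x y [Ix Lx] [Iy Ly]|x r [Ix Lx]].
  by split; [exact: ID|exact: LD].
by split; [exact: IM|exact: LM].
Qed.

Lemma right_ideal_rsum I L : right_ideal I -> right_ideal L -> right_ideal (rsum I L).
Proof.
move=> [I0 ID IM] [L0 LD LM]; split.
- by exists 0 => //; exists 0; rewrite ?addr0.
- move=> _ _ [a Ia [b Lb ->]] [a' Ia' [b' Lb' ->]].
  exists (a + a'); first exact: ID.
  by exists (b + b'); [exact: LD|rewrite addrACA].
- move=> _ r [a Ia [b Lb ->]]; exists (a * r); first exact: IM.
  by exists (b * r); [exact: LM|rewrite mulrDl].
Qed.

Lemma right_ideal_principal a : right_ideal (rprincipal a).
Proof.
split=> [|_ _ [r _ <-] [s _ <-]|_ s [r _ <-]].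
- by exists 0; rewrite ?mulr0.
- by exists (r + s); rewrite ?mulrDr.
- by exists (r * s); rewrite ?mulrA.
Qed.

Lemma rsum_subl A B : B 0 -> A `<=` rsum A B.
Proof. by move=> B0 a Aa; exists a => //; exists 0; rewrite ?addr0. Qed.

Lemma rsum_subr A B : A 0 -> B `<=` rsum A B.
Proof. by move=> A0 b Bb; exists 0 => //; exists b; rewrite ?add0r. Qed.

Lemma rsum_sub A B I : right_ideal I -> A `<=` I -> B `<=` I -> rsum A B `<=` I.
Proof.
move=> [_ ID _] AI BI _ [a Aa [b Bb ->]].
by apply: ID; [exact: AI|exact: BI].
Qed.

Lemma rprincipal_id a : rprincipal a a.
Proof. by exists 1; rewrite ?mulr1. Qed.

Lemma rprincipal_sub a I : right_ideal I -> I a -> rprincipal a `<=` I.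
Proof. by move=> [_ _ IM] Ia _ [r _ <-]; exact: IM. Qed.

(** Otherwise each member of [F] has a strictly larger one, and iterating a choice of it from [A]
    gives a chain that never stabilizes. *)
Lemma noetherian_maximal (F : set (set R)) A :
  right_noetherian R -> (forall B, F B -> right_ideal B) -> F A ->
  exists2 B, F B & forall C, F C -> B `<=` C -> C `<=` B.
Proof.
move=> nR Fr FA; apply: contrapT => noMax.
have /choice[h hP] B : exists C, F B -> [/\ F C, B `<=` C & ~ C `<=` B].
  have [FB|nFB] := pselect (F B); last by exists B.
  apply: contrapT => nC; apply: noMax; exists B => // C FC BC.
  by apply: contrapT => CB; apply: nC; exists C.
have FD n : F (iter n h A) by elim: n => [//|n /hP[]].
have [n|n|N DN] := nR (fun n => iter n h A); first exact: Fr (FD n).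
  by have [] := hP _ (FD n).
by have [_ _] := hP _ (FD N); apply; rewrite -[h _]/(iter N.+1 h A) DN.
Qed.

Lemma chain_sub D m n : (forall k, D k.+1 `<=` D k) -> (m <= n)%N -> D n `<=` D m.
Proof.
move=> decD; elim: n => [|n IHn]; first by rewrite leqn0 => /eqP->.
rewrite leq_eqVlt => /predU1P[<-//|mn]; apply: subset_trans (IHn mn).
exact: decD.
Qed.

Lemma dcc_refl A : dcc_between A A.
Proof.
move=> D _ _ AD DA; exists 0%N => n _.
by apply/seteqP; split=> x /DA/AD.
Qed.

(** An extension of artinian modules is artinian: the intersections of [D n] with [B] and the sums
    of [D n] and [B] both stabilize, and by the modular law so does [D n]. *)
Lemma dcc_trans A B C : right_ideal B -> right_ideal C -> A `<=` B -> B `<=` C ->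
  dcc_between A B -> dcc_between B C -> dcc_between A C.
Proof.
move=> rB rC AB BC dAB dBC D rD decD AD DC; have [B0 BD BM] := rB.
have D0 n : D n 0 by have [] := rD n.
have [n|n|n|n|N DN] := dAB (fun n => D n `&` B).
- exact: right_idealI (rD n) rB.
- by apply: setSI; exact: decD.
- by move=> x Ax; split; [exact: AD|exact: AB].
- by move=> x [].
have [n|n|n|n|N' DN'] := dBC (fun n => rsum (D n) B).
- exact: right_ideal_rsum (rD n) rB.
- by move=> _ [d Dd [b Bb ->]]; exists d; [exact: decD|exists b].
- exact: rsum_subr.
- exact: rsum_sub.
exists (maxn N N') => n; rewrite geq_max => /andP[Nn N'n].
set m := maxn N N'.
have mn : (m <= n)%N by rewrite geq_max Nn.
apply/seteqP; split=> [|x Dx]; first exact: chain_sub mn.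
have [d Dd [b Bb xE]] : rsum (D n) B x.
  rewrite (DN' _ N'n) -(DN' m) ?leq_maxr//.
  exact: rsum_subl.
have [_ DnD _] := rD n.
rewrite xE; apply: DnD => //.
have : (D m `&` B) b.
  split=> //; rewrite -(addKr d b) -xE addrC; apply: right_idealB => //.
  exact: chain_sub mn _ Dd.
by rewrite (DN m) ?leq_maxl// -(DN n)// => -[].
Qed.

(** Left multiplication by [a] makes (L + aR)/L a quotient of R/J, so the chain is pulled back along
    it. *)
Lemma dcc_principal J L a : right_ideal L -> (forall j, J j -> L (a * j)) ->
  dcc_between J setT -> dcc_between L (rsum L (rprincipal a)).
Proof.
move=> [L0 LD LM] aJ dJ D rD decD LDn DL.
have [n|n|n|n|N DN] := dJ (fun n => [set r | D n (a * r)]).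
- have [D0 DD DM] := rD n; split=> [|x y /= Dx Dy|x r /= Dx] /=.
  + by rewrite mulr0.
  + by rewrite mulrDr; exact: DD.
  + by rewrite mulrA; exact: DM.
- by move=> r /=; exact: decD.
- by move=> j /aJ; exact: LDn.
- by [].
exists N => n Nn; apply/seteqP; split=> [|x Dx]; first exact: chain_sub Nn.
have [l Ll [_ [r _ <-] xE]] := DL _ _ Dx.
have [_ DD _] := rD n; rewrite xE; apply: DD; first exact: LDn.
have : [set r | D N (a * r)] r.
  by rewrite /= -(addKr l (a * r)) -xE addrC; apply: right_idealB (LDn _ _ Ll).
by rewrite -(DN n).
Qed.

(* M/L is a finitely generated module over R/J; take B maximal in [L, M] with B/L
   artinian. *)
Lemma dcc_quotient_module J L M : right_noetherian R -> dcc_between J setT ->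
  right_ideal L -> right_ideal M -> L `<=` M ->
  (forall m j, M m -> J j -> L (m * j)) -> dcc_between L M.
Proof.
move=> nR dJ rL rM LM MJ.
have [||B [rB LB BM dB] Bmax] := @noetherian_maximal
    (fun B => [/\ right_ideal B, L `<=` B, B `<=` M & dcc_between L B]) L nR.
- by move=> B [].
- by split=> //; exact: dcc_refl.
suff MB : M `<=` B by rewrite (_ : M = B)//; apply/seteqP.
move=> a Ma.
have rC := right_ideal_rsum rB (right_ideal_principal a).
have BC : B `<=` rsum B (rprincipal a).
  by apply: rsum_subl; have [] := right_ideal_principal a.
have aC : rsum B (rprincipal a) a.
  by apply: rsum_subr; [have [] := rB|exact: rprincipal_id].
apply: (Bmax _ _ BC) aC; split=> //.
- exact: subset_trans BC.
- by apply: rsum_sub => //; exact: rprincipal_sub.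
- apply: dcc_trans (dB) _ => //; apply: (dcc_principal rB _ dJ) => j Jj.
  by apply: LB; exact: MJ.
Qed.

Lemma dcc_filtration J (M : nat -> set R) k : right_noetherian R ->
  dcc_between J setT -> (forall n, right_ideal (M n)) ->
  (forall n, M n.+1 `<=` M n) -> (forall n m j, M n m -> J j -> M n.+1 (m * j)) ->
  dcc_between (M k) (M 0%N).
Proof.
move=> nR dJ rM decM MJ; elim: k => [|k IHk]; first exact: dcc_refl.
apply: dcc_trans (rM k) (rM 0%N) (decM k) _ _ IHk; first exact: chain_sub.
by apply: dcc_quotient_module nR dJ _ _ _ _ => // m j; exact: MJ.
Qed.

End ChainConditions.

(** * Noetherian rings whose nonzero right ideals contain nonzero idempotents *)

Section IdempotentRings.
Variable R : pzRingType.
Hypothesis nR : right_noetherian R.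
Hypothesis idem : forall a : R, a <> 0 ->
  exists c, a * c <> 0 /\ a * c * (a * c) = a * c.

(* For e in I with eR maximal and f a nonzero idempotent of (1 - e)I, the element
   e + f - fe of I is again an idempotent and generates eR + fR. *)
Lemma right_ideal_idempotent (I : set R) : right_ideal I ->
  exists2 e, e * e = e & I = rprincipal e.
Proof.
move=> rI; have [I0 ID IM] := rI.
have [||_ [e [Ie ee ->]] emax] := @noetherian_maximal R
    (fun B => exists e, [/\ I e, e * e = e & B = rprincipal e]) (rprincipal 0) nR.
- by move=> _ [e [_ _ ->]]; exact: right_ideal_principal.
- by exists 0; rewrite mulr0.
exists e => //; apply/seteqP; split; last exact: rprincipal_sub.
move=> b Ib; apply: contrapT => nb.
have [|c [f0 ff]] := @idem (b - e * b).
  by move=> /subr0_eq bE; apply: nb; exists b.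
set f := (b - e * b) * c in f0 ff.
have If : I f by apply: (IM); apply: right_idealB => //; exact: IM.
have ef : e * f = 0 by rewrite /f mulrA mulrBr mulrA ee subrr mul0r.
clearbody f; pose g := e + f - f * e.
have ge : g * e = e by rewrite /g mulrBl mulrDl -mulrA ee addrK.
have gf : g * f = f by rewrite /g mulrBl mulrDl -mulrA ef mulr0 subr0 add0r ff.
have gg : g * g = g by rewrite {2}/g mulrBr mulrDr mulrA ge gf.
have rg := right_ideal_principal g.
have gR x : g * x = x -> rprincipal g x by move=> <-; exists x.
have eg : rprincipal e `<=` rprincipal g by apply: rprincipal_sub => //; exact: gR.
have [|r _ er] := emax _ _ eg f (gR _ gf).
  exists g; split=> //; apply: right_idealB => //; last exact: IM.
  exact: ID.
by apply: f0; rewrite -er -{1}ee -mulrA er ef.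
Qed.

Lemma idempotent_semisimple : semisimple R.
Proof.
move=> _ /right_ideal_idempotent[e ee ->]; exists (rprincipal (1 - e)); split.
- exact: right_ideal_principal.
- apply/seteqP; split=> [_ [[r _ <-] [s _ es]]|_ ->]; last first.
    by split; exists 0; rewrite ?mulr0.
  by rewrite /= -ee -mulrA -es mulrA mulrBr mulr1 ee subrr mul0r.
- move=> x; exists (e * x); first by exists x.
  by exists ((1 - e) * x); [exists x|rewrite -mulrDl addrC subrK mul1r].
Qed.

Lemma idempotent_artinian : right_artinian R.
Proof.
move=> I rI decI.
have /choice[e eP] n : exists e, e * e = e /\ I n = rprincipal e.
  by have [e ee IE] := right_ideal_idempotent (rI n); exists e.
(* [f n] still generates [I n], and the extra factors give [f n.+1 * f n = f n.+1], which makes the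
   complements comparable. *)
pose f := fix f n := if n is m.+1 then e n * f m else e 0%N.
have fP n : f n * f n = f n /\ I n = rprincipal (f n).
  elim: n => [|n [ff IE]]; first exact: eP.
  have [ee IE'] := eP n.+1; rewrite /= IE'.
  have fe : f n * e n.+1 = e n.+1.
    have : I n (e n.+1) by apply: decI; rewrite IE'; exact: rprincipal_id.
    by rewrite IE => -[r _ <-]; rewrite mulrA ff.
  split; first by rewrite mulrA -(mulrA (e _)) fe ee.
  apply/seteqP; split; apply: rprincipal_sub; try exact: right_ideal_principal.
    by exists (e n.+1); rewrite // -mulrA fe ee.
  by exists (f n).
have fI n x : I n x -> f n * x = x.
  by have [ff ->] := fP n => -[r _ <-]; rewrite mulrA ff.
(* The complements (1 - f n)R increase. *)
have [n|n|N LN] := nR (I := fun n => rprincipal (1 - f n)).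
- exact: right_ideal_principal.
- apply: rprincipal_sub; first exact: right_ideal_principal.
  exists (1 - f n) => //; rewrite mulrBr mulr1 mulrBl mul1r /= -mulrA.
  by have [-> _] := fP n; rewrite opprB addrA subrK.
exists N => n Nn; apply/seteqP; split=> [|x Ix]; first exact: chain_sub Nn.
have [fn IE] := fP n; rewrite IE; exists x => //.
(* Equality of the complements forces [f N = f n]. *)
have : rprincipal (1 - f N) (1 - f n) by rewrite -(LN n)//; exact: rprincipal_id.
have [fN _] := fP N; move=> [r _ rE].
have fNn : f N * f n = f n.
  by apply: fI; apply: chain_sub Nn _ _ => //; rewrite IE; exact: rprincipal_id.
have : f N * (1 - f n) = 0 by rewrite -rE mulrA mulrBr mulr1 fN subrr mul0r.
by rewrite mulrBr mulr1 fNn => /subr0_eq <-; exact: fI.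
Qed.

End IdempotentRings.

(** * Right ideals of a quotient ring *)

Section QuotientChains.
Variables (R : pzRingType) (I : ideal R).

Lemma right_ideal_preim (A : set (ideal_quot I)) : right_ideal A ->
  right_ideal (quot_proj I @^-1` A).
Proof.
move=> [A0 AD AM]; split=> [|x y Ax Ay|x r Ax]; rewrite /preimage /=.
- by rewrite raddf0.
- by rewrite quot_projD; exact: AD.
- by rewrite rmorphM; exact: AM.
Qed.

Lemma right_ideal_im (A : set R) : right_ideal A -> right_ideal (quot_proj I @` A).
Proof.
move=> [A0 AD AM]; split=> [|_ _ [x Ax <-] [y Ay <-]|_ r [x Ax <-]].
- by exists 0; rewrite ?raddf0.
- by exists (x + y); [exact: AD|rewrite quot_projD].
- by exists (x * repr r); [exact: AM|rewrite rmorphM /= quot_projK].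
Qed.

Lemma quot_preim_inj (A B : set (ideal_quot I)) :
  quot_proj I @^-1` A = quot_proj I @^-1` B -> A = B.
Proof.
move=> AB; apply/seteqP; split=> x; rewrite -(quot_projK x).
  by rewrite -[A _]/((quot_proj I @^-1` A) _) AB.
by rewrite -[B _]/((quot_proj I @^-1` B) _) -AB.
Qed.

Lemma quot_im_inj (A B : set R) : right_ideal A -> right_ideal B ->
  I `<=` A -> I `<=` B -> quot_proj I @` A = quot_proj I @` B -> A = B.
Proof.
suff sub (C D : set R) : right_ideal D -> I `<=` D ->
    quot_proj I @` C = quot_proj I @` D -> C `<=` D.
  by move=> rA rB IA IB AB; apply/seteqP; split; apply: sub.
move=> [_ DD _] ID CD x Cx; have : (quot_proj I @` C) (quot_proj I x) by exists x.
rewrite CD => -[y Dy /esym/quot_projE/ID Dxy].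
by rewrite -(subrK y x); exact: DD.
Qed.

Lemma quot_noetherian : right_noetherian R -> right_noetherian (ideal_quot I).
Proof.
move=> nR A rA incA; have [n|n|N AN] := nR (fun n => quot_proj I @^-1` A n).
- exact: right_ideal_preim.
- by move=> x; exact: incA.
- by exists N => n /AN/quot_preim_inj.
Qed.

Lemma right_artinian_quotP :
  right_artinian (ideal_quot I) <-> dcc_between (ideal_set I) setT.
Proof.
split=> [aQ D rD decD ID _|dI A rA decA].
  have [n|n|N DN] := aQ (fun n => quot_proj I @` D n).
  - exact: right_ideal_im.
  - exact: image_subset.
  - by exists N => n /DN/quot_im_inj; apply.
have [n|n|n|//|N AN] := dI (fun n => quot_proj I @^-1` A n).
- exact: right_ideal_preim.
- by move=> x; exact: decA.
- move=> x Ix; have [A0 _ _] := rA n.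
  suff : quot_proj I x = 0 by rewrite /preimage /= => ->.
  by rewrite -(raddf0 (quot_proj I)); apply/quot_projE; rewrite subr0.
- by exists N => n /AN/quot_preim_inj.
Qed.

End QuotientChains.

(** * The Jacobson radical and right inverses *)

Section JacobsonRadical.
Variable R : pzRingType.
Hypothesis nR : right_noetherian R.

Lemma right_ideal_maximal (A : set R) : right_ideal A -> ~ A 1 ->
  exists2 M, maximal_right_ideal M & A `<=` M.
Proof.
move=> rA nA; have [||M [rM AM nM] Mmax] := @noetherian_maximal R
    (fun B => [/\ right_ideal B, A `<=` B & ~ B 1]) A nR.
- by move=> B [].
- by split.
exists M => //; split=> // [MT|B rB MB]; first by apply: nM; rewrite MT.
have [B1|nB] := pselect (B 1).
  by right; apply/seteqP; split=> // x _; rewrite -(mul1r x); have [_ _] := rB; apply.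
left; apply/seteqP; split=> //; apply: Mmax => //; split=> //.
exact: subset_trans MB.
Qed.

(** If (1 - j)R were proper, it would lie in a maximal right ideal, which also contains [j] and
    hence 1. *)
Lemma jacobson_right_inverse j : jacobson_set R j -> exists z, (1 - j) * z = 1.
Proof.
move=> Jj; apply: contrapT => nz.
have [[z _ z1]|M mM AM] := @right_ideal_maximal _ (right_ideal_principal (1 - j)).
  by apply: nz; exists z.
have [[_ MD _] MT _] := mM; have M1 : M 1.
  rewrite -(subrK j 1); apply: MD; first exact/AM/rprincipal_id.
  exact: Jj.
apply: MT; apply/seteqP; split=> // x _; rewrite -(mul1r x).
by have [[_ _ MM] _ _] := mM; exact: MM.
Qed.

Lemma jacobson_idempotent e : e * e = e -> jacobson_set R e -> e = 0.
Proof.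
move=> ee /jacobson_right_inverse[z z1].
by rewrite -(mulr1 e) -z1 mulrA mulrBr mulr1 ee subrr mul0r.
Qed.

(** If a maximal [M] omits [a], then [1 = m + a * r] with [m] in [M], and the right inverse of
    [m = 1 - a * r] puts 1 in [M]. *)
Lemma jacobson_intro a : (forall r, exists z, (1 - a * r) * z = 1) -> jacobson_set R a.
Proof.
move=> inv M mM; have [rM MT Mmax] := mM; apply: contrapT => Ma.
have [M0 MD MM] := rM.
have rS := right_ideal_rsum rM (right_ideal_principal a).
have MS : M `<=` rsum M (rprincipal a).
  by apply: rsum_subl; have [] := right_ideal_principal a.
have [SM|ST] := Mmax _ rS MS.
  by apply: Ma; rewrite -SM; apply: rsum_subr => //; exact: rprincipal_id.
have [m Mm [_ [r _ <-] mE]] : rsum M (rprincipal a) 1 by rewrite ST.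
have [z z1] := inv r; apply: MT; apply/seteqP; split=> // x _.
by rewrite -(mul1r x) -z1; apply/MM/MM; rewrite mE addrK.
Qed.

End JacobsonRadical.

(** * Levitzki's theorem modulo an ideal *)

Section Levitzki.
Variable R : pzRingType.
Implicit Types (B K N : ideal R) (s : seq R).

(** Bare products are easier to regroup than the nested sums of [ideal_exp]; [ideal_expP] converts
    back. *)
Definition nilpotent_mod K (A : set R) : Prop :=
  exists m, forall s, size s = m -> (forall x, x \in s -> A x) ->
    ideal_set K (\prod_(x <- s) x).

(** The induction carries a left multiplier [w] that collects the factors already extracted from the
    nested sums. *)
Lemma ideal_expP (A K : ideal R) n :
  (forall s, size s = n -> (forall x, x \in s -> ideal_set A x) ->
    ideal_set K (\prod_(x <- s) x)) ->
  ideal_exp A n `<=` K.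
Proof.
have [K0 KD KM] := ideal_right K.
suff gen x w : (forall s, size s = n -> (forall y, y \in s -> ideal_set A y) ->
    ideal_set K (w * \prod_(y <- s) y)) ->
    ideal_set (ideal_exp A n) x -> ideal_set K (w * x).
  move=> sK x /(gen _ 1); rewrite mul1r; apply=> s sn sA.
  by rewrite mul1r; exact: sK.
elim: n x w => [|n IHn] x w sK.
  by move=> _; apply: KM; have := sK [::] erefl; rewrite big_nil mulr1; apply.
move=> [t tP ->]; rewrite mulr_sumr.
elim: t tP => [|p t IHt] tP; first by rewrite big_nil.
rewrite big_cons; apply: KD; last by apply: IHt => q qt; apply: tP; rewrite inE qt orbT.
have [Ap Ep] := tP p (mem_head _ _).
rewrite mulrA; apply: IHn Ep => s sn sA; rewrite -mulrA.
have := sK (p.1 :: s); rewrite big_cons /= sn; apply=> // y.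
by rewrite inE => /predU1P[->|/sA].
Qed.

(** A product of [m.*2] elements of [B] is grouped into [m] consecutive pairs, each lying in [A]. *)
Lemma nilpotent_mod_square K (A B : set R) :
  (forall x y, B x -> B y -> A (x * y)) -> nilpotent_mod K A -> nilpotent_mod K B.
Proof.
move=> BBA [m AK]; exists m.*2 => s sm sB.
suff [t [tm tA ->]] : exists t, [/\ size t = m, (forall x, x \in t -> A x) &
    \prod_(x <- s) x = \prod_(x <- t) x] by exact: AK.
elim: m s sm sB {AK} => [|m IHm] s; first by move=> /size0nil-> _; exists [::].
case: s => [//|x [//|y s]] [sm] sB.
have [z zs|t [tm tA tE]] := IHm s sm; first by apply: sB; rewrite !inE zs !orbT.
exists (x * y :: t); split; rewrite /= ?tm ?big_cons ?tE ?mulrA// => z.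
rewrite inE => /predU1P[->|/tA//]; apply: BBA; apply: sB; rewrite !inE eqxx ?orbT//.
Qed.

(* In the proof, B is a maximal ideal among those nilpotent modulo K, and a is an
   element of N outside B with {r | a r in B} maximal.  Nilpotence of x a modulo K
   gives a x a in B for all x; then with C = {x | a R x <= B} the ideal
   B' = {x in C | x C <= B} contains a and satisfies B'^2 <= B. *)
Lemma levitzki K N : right_noetherian R ->
  (forall x, ideal_set N x -> exists n, ideal_set K (x ^+ n)) ->
  exists n, ideal_exp N n `<=` K.
Proof.
move=> nR nilN.
have [||_ [B [-> nilB KB]] Bmax] := @noetherian_maximal R
    (fun A => exists B : ideal R, [/\ A = B, nilpotent_mod K B & K `<=` B]) K nR.
- by move=> _ [B [-> _ _]]; exact: ideal_right.
- exists K; split=> //; exists 1%N => -[//|x [|//]] _ sK.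
  by rewrite big_seq1; apply: sK; rewrite inE.
have [B0 BD BM] := ideal_right B; have lB := @ideal_left _ B.
suff NB : N `<=` B.
  have [m mB] := nilB; exists m; apply: ideal_expP => s sm sN.
  by apply: mB => // x /sN/NB.
move=> a0 Na0; apply: contrapT => nBa0.
have [||_ [a [-> Na nBa]] amax] := @noetherian_maximal R
    (fun A => exists a, [/\ A = [set r | ideal_set B (a * r)], ideal_set N a &
       ~ ideal_set B a]) [set r | ideal_set B (a0 * r)] nR.
- move=> _ [a [-> _ _]]; split=> [|x y|x r] /=; rewrite ?mulr0 ?mulrDr ?mulrA//.
    exact: BD.
  exact: BM.
- by exists a0.
have aRa x : ideal_set B (a * x * a).
  have [k Kk] := nilN _ (ideal_left x Na).
  have {Kk} : ideal_set B ((x * a) ^+ k.+1) by rewrite exprS; exact/lB/KB.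
  rewrite -mulrA; elim: k => [|k IHk]; first by rewrite expr1; exact: lB.
  have [/IHk//|nBk Bk] := pselect (ideal_set B ((x * a) ^+ k.+1)).
  (* This power lies in [N] and outside [B], and its right annihilator modulo [B] contains that of
     [a]. By maximality the two agree, and the larger one contains [x * a]. *)
  apply: (amax [set r | ideal_set B ((x * a) ^+ k.+1 * r)]).
  - exists ((x * a) ^+ k.+1); split=> //.
    by rewrite exprSr mulrA; apply: ideal_left.
  - by move=> r /= Bar; rewrite exprSr -!mulrA; do 2!apply: (lB).
  - by rewrite /= -exprSr.
pose C := [set x | forall r, ideal_set B (a * r * x)].
have Cl r x : C x -> C (r * x) by move=> Cx s; rewrite mulrA -(mulrA a); exact: Cx.
pose B' := [set x | C x /\ forall c, C c -> ideal_set B (x * c)].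
have rB' : right_ideal B'.
  split=> [|x y [Cx xC] [Cy yC]|x r [Cx xC]].
  - by split=> [r|c _]; rewrite ?mulr0 ?mul0r.
  - split=> [r|c Cc]; first by rewrite mulrDr; exact: BD.
    by rewrite mulrDl; apply: BD; [exact: xC|exact: yC].
  - split=> [s|c Cc]; first by rewrite mulrA; exact: BM.
    by rewrite -mulrA; exact/xC/Cl.
have lB' r x : B' x -> B' (r * x).
  by move=> [Cx xC]; split=> [|c Cc]; [exact: Cl|rewrite -mulrA; exact/lB/xC].
have BB' : B `<=` B'.
  by move=> x Bx; split=> [r|c _]; [exact: lB|exact: BM].
apply: nBa; apply: (Bmax B') => //.
  exists (Ideal rB' lB'); split=> //; last exact: subset_trans BB'.
  by apply: nilpotent_mod_square nilB => x y [_ xC] [Cy _]; exact: xC.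
split=> [r|c /(_ 1)]; last by rewrite mulr1.
exact: aRa.
Qed.

End Levitzki.

(** * Finitely generated right ideals *)

Section RightSpan.
Variable R : pzRingType.
Implicit Types (A B J : set R) (s : seq R).

(** When [A] is an ideal, this is the product by [A] of the right ideal generated by [s]. Fixing the
    generators lets coefficients be summed one generator at a time. *)
Fixpoint rspan A s : set R :=
  if s is a :: s' then rsum [set a * c | c in A] (rspan A s') else [set 0].

Lemma right_ideal_lmul a A : right_ideal A -> right_ideal [set a * c | c in A].
Proof.
move=> [A0 AD AM]; split=> [|_ _ [r Ar <-] [s As <-]|_ s [r Ar <-]].
- by exists 0; rewrite ?mulr0.
- by exists (r + s); rewrite ?mulrDr//; exact: AD.
- by exists (r * s); rewrite ?mulrA//; exact: AM.
Qed.

Lemma right_ideal_rspan A s : right_ideal A -> right_ideal (rspan A s).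
Proof.
move=> rA; elim: s => [|a s IHs] /=.
  by split=> // [_ _ -> ->|_ r ->]; rewrite ?addr0 ?mul0r.
by apply: right_ideal_rsum => //; exact: right_ideal_lmul.
Qed.

Lemma rspan_mono A B s : A `<=` B -> rspan A s `<=` rspan B s.
Proof.
move=> AB; elim: s => [//|a s IHs] /= _ [_ [c Ac <-] [y Ay ->]].
by exists (a * c); [exists c => //; exact: AB|exists y => //; exact: IHs].
Qed.

Lemma rspan_mulr A B J s x j : (forall c i, A c -> J i -> B (c * i)) ->
  rspan A s x -> J j -> rspan B s (x * j).
Proof.
move=> AJB + Jj; elim: s x => [x ->|a s IHs _ [_ [c Ac <-] [y Ay ->]]] /=.
  by rewrite mul0r.
exists (a * (c * j)); first by exists (c * j) => //; exact: AJB.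
by exists (y * j); [exact: IHs|rewrite mulrDl mulrA].
Qed.

Lemma right_ideal_fg (A : set R) : right_noetherian R -> right_ideal A ->
  exists s, A = rspan setT s.
Proof.
move=> nR rA; have [A0 AD AM] := rA.
have [||_ [s [-> sA]] smax] := @noetherian_maximal R
    (fun B => exists s, B = rspan setT s /\ B `<=` A) [set 0] nR.
- by move=> _ [s [-> _]]; exact: right_ideal_rspan.
- by exists [::]; split=> // _ ->.
exists s; apply/seteqP; split=> // a Aa.
have [s0 _ _] := right_ideal_rspan s (idealT_right R).
apply: (smax (rspan setT (a :: s))) => /=.
- exists (a :: s); split=> //; apply: rsum_sub => //.
  exact: rprincipal_sub.
- by apply: rsum_subr; exists 0; rewrite ?mulr0.
- by apply: rsum_subl => //; exact: rprincipal_id.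
Qed.

End RightSpan.

(** [ideal_exp] adds factors on the left, whereas filtrations of right modules need them on the
    right. *)
Lemma ideal_exp_mulr (R : pzRingType) (I : ideal R) n x j :
  ideal_set (ideal_exp I n) x -> ideal_set I j -> ideal_set (ideal_exp I n.+1) (x * j).
Proof.
move=> + Ij; elim: n x => [|n IHn] x.
  move=> _; exists [:: (x * j, 1)]; last by rewrite big_seq1 mulr1.
  by move=> _ /predU1P[->|//]; split=> //=; exact: ideal_left.
move=> [s sP ->]; exists [seq (p.1, p.2 * j) | p <- s].
  by move=> _ /mapP[p /sP[Ip Ep] ->]; split=> //; exact: IHn.
by rewrite big_map mulr_suml; apply: eq_bigr => p _; rewrite mulrA.
Qed.

(** * Rings complete for a directed family of ideals, with Drazin inverses modulo that family *)

Section ProPiRegular.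
Variables (R : pzRingType) (T : Type) (K : T -> ideal R).
Hypothesis nR : right_noetherian R.
Hypothesis K_inhabited : exists i : T, True.
Hypothesis K_directed : forall i j, exists k, K k `<=` K i /\ K k `<=` K j.
Hypothesis K_separated : forall x, (forall i, ideal_set (K i) x) -> x = 0.
Hypothesis K_complete : forall x : T -> R,
  (forall i j, K j `<=` K i -> ideal_set (K i) (x i - x j)) ->
  exists y, forall i, ideal_set (K i) (y - x i).
Hypothesis K_drazin : forall a, exists2 x, drazin_inverse a x &
  forall i, exists n, ideal_set (K i) (a ^+ n * (1 - a * x)).

Implicit Types (A : set R) (a x y : R).

Let J n := ideal_exp (jacobson R) n.

(** Modulo each [K i], left multiplication by [1 - t] is injective because [t] is nilpotent there.
    The powers of [1 - t] in the Drazin relation can thus be cancelled, so the Drazin inverse is a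
    right inverse. *)
Lemma top_nilpotent_right_inverse t :
  (forall i, exists n, ideal_set (K i) (t ^+ n)) -> exists z, (1 - t) * z = 1.
Proof.
move=> nilt; have [x _ ux] := K_drazin (1 - t); exists x.
apply/esym/subr0_eq/K_separated => i.
have [K0 KD KM] := ideal_right (K i).
have cancel z : ideal_set (K i) ((1 - t) * z) -> ideal_set (K i) z.
  move=> Kz; have [m /(KM _ z)] := nilt i; elim: m => [|m IHm]; first by rewrite mul1r.
  move=> Ktz; apply: IHm; rewrite -(subrK (t ^+ m.+1 * z) (t ^+ m * z)).
  apply: KD => //.
  rewrite -mulrBl exprSr -{1}(mulr1 (t ^+ m)) -mulrBr -mulrA.
  exact: ideal_left.
have [n] := ux i; elim: n => [|n IHn]; first by rewrite mul1r.
by rewrite exprS -mulrA => /cancel.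
Qed.

(** With [x] the Drazin inverse, [j * x] is an idempotent of the radical, hence zero, and the Drazin
    relation reduces to [j ^+ n]. *)
Lemma jacobson_top_nilpotent j i : jacobson_set R j ->
  exists n, ideal_set (K i) (j ^+ n).
Proof.
move=> Jj; have [x [jx xjx] /(_ i)[n]] := K_drazin j.
have -> : j * x = 0.
  apply: (jacobson_idempotent nR); first by rewrite -mulrA (mulrA x) xjx.
  by have [_ _] := jacobson_right R; apply.
by rewrite subr0 mulr1; exists n.
Qed.

(** Otherwise each idempotent [a * r * x], with [x] the Drazin inverse of [a * r], lies in the
    radical and vanishes. Then [a * r] is nilpotent modulo every [K i], so [1 - a * r] is right
    invertible and [a] lies in the radical. *)
Lemma not_jacobson_idempotent a : ~ jacobson_set R a ->
  exists c, ~ jacobson_set R (a * c) /\ a * c * (a * c) = a * c.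
Proof.
move=> nJa; apply: contrapT => nidem; apply: nJa; apply: jacobson_intro => r.
apply: top_nilpotent_right_inverse => i.
have [x [bx xbx] /(_ i)[n Kn]] := K_drazin (a * r); exists n.
have ee : a * r * x * (a * r * x) = a * r * x.
  by rewrite -(mulrA (a * r)) (mulrA x) xbx.
have [Je|nJe] := pselect (jacobson_set R (a * r * x)).
  by move: Kn; rewrite (jacobson_idempotent nR ee Je) subr0 mulr1.
by case: nidem; exists (r * x); rewrite (mulrA a); split.
Qed.

Lemma quot_jacobson_idempotent (a : ideal_quot (jacobson R)) : a <> 0 ->
  exists c, a * c <> 0 /\ a * c * (a * c) = a * c.
Proof.
rewrite -(quot_projK a) => a0.
have quot0 x : (quot_proj (jacobson R) x = 0) <-> jacobson_set R x.
  rewrite -(raddf0 (quot_proj (jacobson R))).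
  by split=> [/quot_projE|Jx]; [|apply/quot_projE]; rewrite subr0.
have [|c [nJ ee]] := @not_jacobson_idempotent (repr a); first by move=> /quot0.
by exists (quot_proj _ c); rewrite -!rmorphM ee; split=> // /quot0.
Qed.

Lemma quot_jacobson_semisimple : semisimple (ideal_quot (jacobson R)).
Proof.
exact: idempotent_semisimple (quot_noetherian nR) quot_jacobson_idempotent.
Qed.

Lemma quot_jacobson_artinian : right_artinian (ideal_quot (jacobson R)).
Proof.
exact: idempotent_artinian (quot_noetherian nR) quot_jacobson_idempotent.
Qed.

Lemma dcc_jacobson : dcc_between (jacobson_set R) setT.
Proof. exact: (right_artinian_quotP (jacobson R)).1 quot_jacobson_artinian. Qed.

Lemma quot_jacobson_exp_artinian n : right_artinian (ideal_quot (J n)).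
Proof.
apply/right_artinian_quotP.
have := @dcc_filtration _ _ (fun m => ideal_set (J m)) n nR dcc_jacobson.
apply=> [m|m|m x j]; [exact: ideal_right|exact: ideal_exp_le|exact: ideal_exp_mulr].
Qed.

Lemma jacobson_exp_sub i : exists n, J n `<=` K i.
Proof. by apply: levitzki nR _ => j /jacobson_top_nilpotent. Qed.


(** This is the intersection of the sums of [A] and [K i], the closure for the topology with the
    [K i] as basic neighbourhoods of zero. *)
Definition adic_closure A : set R :=
  [set x | forall i, exists2 a, A a & ideal_set (K i) (x - a)].

Lemma subset_adic_closure A : A `<=` adic_closure A.
Proof. by move=> a Aa i; exists a; rewrite ?subrr//; have [] := ideal_right (K i). Qed.

Lemma adic_closure_mono A B : A `<=` B -> adic_closure A `<=` adic_closure B.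
Proof. by move=> AB x xA i; have [a Aa Kxa] := xA i; exists a => //; exact: AB. Qed.

Lemma right_ideal_adic_closure A : right_ideal A -> right_ideal (adic_closure A).
Proof.
move=> [A0 AD AM]; split=> [|x y xA yA i|x r xA i]; first exact: subset_adic_closure.
all: have [a Aa Ka] := xA i; have [_ KD KM] := ideal_right (K i).
  have [b Ab Kb] := yA i; exists (a + b); first exact: AD.
  by rewrite opprD addrACA; exact: KD.
by exists (a * r); [exact: AM|rewrite -mulrBl; exact: KM].
Qed.

Let C n := adic_closure (J n).

Lemma left_ideal_adic_closure n r x : C n x -> C n (r * x).
Proof.
move=> Cx i; have [a Ja Ka] := Cx i; exists (r * a); first exact: ideal_left.
by rewrite -mulrBr; exact: ideal_left.
Qed.

Lemma adic_closure_jacobson_exp_sub i : exists n, C n `<=` K i.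
Proof.
have [n JK] := jacobson_exp_sub i; exists n => x /(_ i)[a /JK Ka Kxa].
by rewrite -(subrK a x); have [_ KD _] := ideal_right (K i); exact: KD.
Qed.

(** Since R/J^n is artinian, some J^n + K_i is minimal, and by directedness it is the least. Then
    K_i lies in every J^n + K_j, that is, in the closure of J^n. *)
Lemma adic_closure_jacobson_exp_open n : exists i, K i `<=` C n.
Proof.
have rJ := ideal_right (J n).
suff [i iP] : exists i, forall j, rsum (J n) (K i) `<=` rsum (J n) (K j).
  exists i => x Kx j; have [J0 _ _] := rJ.
  have [a Ja [b Kb ->]] := iP j _ (rsum_subr J0 Kx).
  by exists a; rewrite // addrAC subrr add0r.
apply: contrapT => nomin.
have /choice[h hP] i : exists k, K k `<=` K i /\
    ~ rsum (J n) (K i) `<=` rsum (J n) (K k).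
  apply: contrapT => nk; apply: nomin; exists i => j; apply: contrapT => nij.
  have [k [ki kj]] := K_directed i j; apply: nk; exists k; split=> // ik.
  apply: nij; apply: subset_trans ik _ => _ [a Ja [b /kj Kb ->]].
  by exists a => //; exists b.
have [i0 _] := K_inhabited.
pose D m := rsum (J n) (K (iter m h i0)).
have dJ : dcc_between (J n) setT.
  exact: (right_artinian_quotP (J n)).1 (@quot_jacobson_exp_artinian n).
have [m|m|m|//|N DN] := dJ D.
- by apply: right_ideal_rsum; exact: ideal_right.
- by move=> _ [a Ja [b /((hP _).1) Kb ->]]; exists a => //; exists b.
- by apply: rsum_subl; have [] := ideal_right (K (iter m h i0)).
by apply: (hP (iter N h i0)).2; rewrite -[rsum _ _]/(D N) -(DN N.+1).
Qed.

Lemma adic_closure_separated x : (forall n, C n x) -> x = 0.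
Proof.
by move=> Cx; apply: K_separated => i; have [n] := adic_closure_jacobson_exp_sub i; apply.
Qed.

(** * Convergent series and closed right ideals *)

Lemma series_tail (c : nat -> R) m n : (forall k, ideal_set (J k) (c k)) ->
  (m <= n)%N -> ideal_set (J m) (\sum_(k < n) c k - \sum_(k < m) c k).
Proof.
move=> Jc; have [J0 JD _] := ideal_right (J m).
elim: n => [|n IHn]; first by rewrite leqn0 => /eqP->; rewrite subrr.
rewrite leq_eqVlt => /predU1P[<-|]; first by rewrite subrr.
rewrite ltnS => mn.
rewrite big_ord_recr /= addrAC; apply: JD; first exact: IHn.
by apply: (ideal_exp_le mn); exact: Jc.
Qed.

(** Modulo [K i] the partial sums are constant from the index [nu i] on, so the values [S (nu i)]
    form a family to which completeness applies. *)
Lemma scalar_series (c : nat -> R) : (forall k, ideal_set (J k) (c k)) ->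
  exists y, forall n, C n (y - \sum_(k < n) c k).
Proof.
move=> Jc; pose S n := \sum_(k < n) c k.
have /choice[nu nuP] i := jacobson_exp_sub i.
have KS i m n : (nu i <= m)%N -> (nu i <= n)%N -> ideal_set (K i) (S m - S n).
  move=> im jn; rewrite -(subrKA (S (nu i))) -(opprB (S n)).
  by apply: right_idealB; [exact: ideal_right|..]; exact/nuP/series_tail.
have [i j ji|y yP] := K_complete (x := fun i => S (nu i)).
  (* [nu] need not be monotone. If [nu j] is the smaller index, the difference lies in [K j], hence
     in [K i]. *)
  have [ij|/ltnW ij] := leqP (nu i) (nu j); first exact: KS.
  exact/ji/KS.
exists y => n i; exists (S (maxn n (nu i)) - S n).
  by apply: series_tail => //; exact: leq_maxl.
rewrite opprB subrKA -(subrKA (S (nu i))).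
have [_ KD _] := ideal_right (K i); apply: KD; first exact: yP.
by apply: KS => //; exact: leq_maxr.
Qed.

(** The coefficients of each generator are summed separately, so the limit stays in the span; left
    multiplication by a generator preserves [C n]. *)
Lemma rspan_series s (p : nat -> R) : (forall k, rspan (J k) s (p k)) ->
  exists2 y, rspan setT s y & forall n, C n (y - \sum_(k < n) p k).
Proof.
elim: s p => [|a s IHs] p pP.
  exists 0 => // n; rewrite big1 ?subrr => [|k _]; last exact: pP.
  by apply: subset_adic_closure; have [] := ideal_right (J n).
have /choice[cq cqP] k : exists cq : R * R, [/\ ideal_set (J k) cq.1,
    rspan (J k) s cq.2 & p k = a * cq.1 + cq.2].
  by have [_ [c Jc <-] [q qP ->]] := pP k; exists (c, q).
have [y1 y1P] : exists y, forall n, C n (y - \sum_(k < n) (cq k).1).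
  by apply: (scalar_series (c := fun k => (cq k).1)) => k; have [] := cqP k.
have [|y2 y2s y2P] := IHs (fun k => (cq k).2); first by move=> k; have [] := cqP k.
exists (a * y1 + y2); first by exists (a * y1); [exists y1|exists y2].
move=> n; rewrite (eq_bigr (fun k : 'I_n => a * (cq k).1 + (cq k).2)); last first.
  by move=> k _; have [] := cqP k.
rewrite big_split -mulr_sumr /= opprD addrACA -mulrBr.
have [_ CD _] := right_ideal_adic_closure (ideal_right (J n)).
by apply: CD; [exact: left_ideal_adic_closure|exact: y2P].
Qed.

(* Mittag-Leffler: the chains A /\ C_n + A J^k stabilize in n, so approximations
   y_k of x in A can be corrected to satisfy y_(k+1) - y_k in A J^k. *)
Lemma right_ideal_adically_closed A : right_ideal A -> adic_closure A `<=` A.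
Proof.
move=> rA x clx; have [A0 AD AM] := rA.
have [s sA] := right_ideal_fg nR rA.
have rC n : right_ideal (C n) by apply: right_ideal_adic_closure; exact: ideal_right.
have decC m n : (m <= n)%N -> C n `<=` C m.
  by move=> mn; apply: adic_closure_mono; exact: ideal_exp_le.
pose M k := rspan (J k) s.
have rM k : right_ideal (M k) by apply: right_ideal_rspan; exact: ideal_right.
have M0 : M 0%N = A by rewrite sA.
have decM k : M k.+1 `<=` M k by apply: rspan_mono; exact: ideal_exp_le.
have MA k : M k `<=` A by rewrite -M0; exact: chain_sub.
have dM k : dcc_between (M k) A.
  rewrite -M0; have := @dcc_filtration _ _ M k nR dcc_jacobson rM decM; apply=> n m j.
  by apply: rspan_mulr => c i; exact: ideal_exp_mulr.
have /choice[N NP] k : exists N, forall n, (N <= n)%N ->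
    rsum (A `&` C n) (M k) = rsum (A `&` C N) (M k).
  apply: (dM k (fun n => rsum (A `&` C n) (M k))) => n.
  - by apply: right_ideal_rsum => //; exact: right_idealI.
  - move=> _ [a [Aa Ca] [b Mb ->]]; exists a; last by exists b.
    by split=> //; exact: (decC _ _ _ _ Ca).
  - by apply: rsum_subr; split=> //; have [] := rC n.
  - by apply: rsum_sub => // y [].
(* [nu k] lies in the stable range for level [k], is nondecreasing, and is at least [k], so the
   [C (nu k)] shrink to zero. *)
pose nu := fix nu k := if k is l.+1 then maxn (nu l).+1 (N l.+1) else N 0%N.
have nuN k : (N k <= nu k)%N by case: k => [|k] //=; exact: leq_maxr.
have nuS k : (nu k <= nu k.+1)%N by rewrite /= leq_max leqnSn.
have nuk k : (k <= nu k)%N.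
  by elim: k => // k IHk; rewrite /= leq_max ltnS IHk.
have approx n : exists2 y, A y & C n (x - y).
  have [i KC] := adic_closure_jacobson_exp_open n; have [y Ay Ky] := clx i.
  by exists y => //; exact: KC.
(* The premises sit under the existential so that choice yields a total function; 0 is the default
   when they fail. *)
have step k y : exists y', A y -> C (nu k) (x - y) ->
    [/\ A y', C (nu k.+1) (x - y') & M k (y' - y)].
  have [z Az Cz] := approx (nu k.+1).
  have [[Ay Cy]|nAC] := pselect (A y /\ C (nu k) (x - y)); last first.
    by exists 0 => Ay Cy; case: nAC.
  (* Stabilization rewrites [z - y] as [u + v] with [u] in [C (nu k.+1)] and [v] in [M k]. Then
     [z - u] approximates [x] as well as [z] does and differs from [y] by [v]. *)
  have : rsum (A `&` C (nu k)) (M k) (z - y).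
    exists (z - y); last by exists 0; rewrite ?addr0//; have [] := rM k.
    split; first exact: right_idealB.
    rewrite -(subrKA x) addrC -(opprB x z).
    by apply: (right_idealB (rC (nu k))) => //; exact: (decC _ _ _ _ Cz).
  rewrite (NP k (nu k))// -(NP k (nu k.+1)); last exact: leq_trans (nuS k).
  move=> [u [Au Cu] [v Mv zy]]; exists (z - u) => _ _; split.
  - exact: right_idealB.
  - by rewrite opprB addrCA addrC; have [_ CD _] := rC (nu k.+1); apply: CD.
  - by rewrite addrAC zy addrAC subrr add0r.
have [f fP] := choice (fun ky : nat * R => step ky.1 ky.2).
have [y0 Ay0 Cy0] := approx (nu 0%N).
pose y := fix y k := if k is l.+1 then f (l, y l) else y0.
have yP k : A (y k) /\ C (nu k) (x - y k).
  by elim: k => [//|k [Ay Cy]]; have [] := fP (k, y k) Ay Cy.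
have yM k : M k (y k.+1 - y k) by have [Ay Cy] := yP k; have [] := fP (k, y k) Ay Cy.
have [z + zP] := rspan_series yM; rewrite -sA => Az.
(* Both [x - y0] and [z] agree with [y n - y0] modulo [C n], for every [n]. *)
suff xE : x - y0 - z = 0.
  by rewrite -(subrK y0 x) (subr0_eq xE); exact: AD.
apply: adic_closure_separated => n.
have := zP n; rewrite -(big_mkord xpredT (fun k => y k.+1 - y k)) telescope_sumr//=.
move=> Cz; have : C n (x - y n - (z - (y n - y0))).
  by apply: (right_idealB (rC n)) Cz; apply: (decC _ _ (nuk n)); have [] := yP n.
by congr (C n); rewrite opprB addrA subrKA addrAC.
Qed.

Lemma jacobson_exp_open n : exists i, K i `<=` J n.
Proof.
have [i KC] := adic_closure_jacobson_exp_open n; exists i.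
by apply: subset_trans KC _; apply: right_ideal_adically_closed; exact: ideal_right.
Qed.

Lemma jacobson_exp_separated x : (forall n, ideal_set (J n) x) -> x = 0.
Proof. by move=> Jx; apply: adic_closure_separated => n; exact: subset_adic_closure. Qed.

Lemma jacobson_exp_complete (s : nat -> R) :
  (forall n, ideal_set (J n) (s n.+1 - s n)) ->
  exists y, forall n, ideal_set (J n) (y - s n).
Proof.
move=> /scalar_series[y yP]; exists (y + s 0%N) => n.
apply: right_ideal_adically_closed; first exact: ideal_right.
have := yP n; rewrite -(big_mkord xpredT (fun k => s k.+1 - s k)) telescope_sumr//.
by rewrite opprB addrA.
Qed.

End ProPiRegular.

(** * Inverse limits of rings and kernels of ring maps *)

Lemma inv_lim_proj_monoid (S : inverse_system) (i : inv_index S) :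
  monoid_morphism (@inv_lim_proj S i).
Proof. by split=> // x y; exact: inv_lim_projM. Qed.

HB.instance Definition _ (S : inverse_system) (i : inv_index S) :=
  GRing.isZmodMorphism.Build (inv_lim S) (S i) (@inv_lim_proj S i) (inv_lim_projB i).
HB.instance Definition _ (S : inverse_system) (i : inv_index S) :=
  GRing.isMonoidMorphism.Build (inv_lim S) (S i) (@inv_lim_proj S i)
    (inv_lim_proj_monoid i).

Section InverseLimitRing.
Variable S : inverse_system.
Implicit Types (x y : inv_lim S) (i j : inv_index S).

Lemma inv_lim_proj_inj x y : (forall i, inv_lim_proj i x = inv_lim_proj i y) -> x = y.
Proof.
move=> xy; apply: val_inj; apply: functional_extensionality_dep => i.
exact: xy.
Qed.

Lemma inv_lim_proj_map i j (ij : inv_le i j) x :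
  inv_map ij (inv_lim_proj j x) = inv_lim_proj i x.
Proof. by have /compatibleP := inv_lim_compatible x; apply. Qed.

Lemma inv_lim_of_compatible (x : forall i, S i) :
  (forall i j (ij : inv_le i j), inv_map ij (x j) = x i) ->
  exists y, forall i, inv_lim_proj i y = x i.
Proof.
move=> xc; have cx : (x : discrete_prod S) \in compatible S by apply/compatibleP.
by exists (InvLim cx).
Qed.

(** By directedness the kernels of the projections generate a filter; it converges to 0, so it
    contains every neighbourhood of 0. *)
Lemma inv_lim_nbhs0 (U : set (inv_lim S)) : nbhs (0 : inv_lim S) U ->
  exists i, forall x, inv_lim_proj i x = 0 -> U x.
Proof.
pose B i := [set x | inv_lim_proj i x = 0].
have [i0 _] := inv_inhabited S.
have FF : Filter (filter_from setT B).
  apply: filter_from_filter; first by exists i0.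
  move=> i j _ _; have [k [ik jk]] := inv_directed i j; exists k => // x Bx.
  by split; rewrite /B /= -(inv_lim_proj_map ik, inv_lim_proj_map jk) Bx rmorph0.
have : (fun x : inv_lim S => x) @ filter_from setT B --> (0 : inv_lim S).
  by apply: inv_lim_cvg => i; exists i => // x; rewrite /B /= rmorph0.
by move=> h /h [i _ BU]; exists i.
Qed.

(** Ring morphisms carry Drazin inverses to Drazin inverses, so uniqueness makes the componentwise
    inverses compatible. *)
Lemma inv_lim_drazin (a : inv_lim S) : (forall i, pi_regular (S i)) ->
  exists2 x, drazin_inverse a x &
    forall i, exists n, inv_lim_proj i (a ^+ n * (1 - a * x)) = 0.
Proof.
move=> piS.
have dex i : exists x : S i, drazin_inverse (inv_lim_proj i a) x /\
    exists n, inv_lim_proj i a ^+ n * (1 - inv_lim_proj i a * x) = 0.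
  by have [x dx nx] := drazin_inverse_exists (inv_lim_proj i a) (piS i); exists x.
pose x i := sval (cid (dex i)).
have xP i : drazin_inverse (inv_lim_proj i a) (x i) /\
    exists n, inv_lim_proj i a ^+ n * (1 - inv_lim_proj i a * x i) = 0.
  exact: svalP (cid (dex i)).
have [i j ij|y yx] := @inv_lim_of_compatible x.
  have [[jx1 jx2] [n jn]] := xP j; have [ix [m im]] := xP i.
  apply: (drazin_inverse_unique (n := n) _ _ ix im); last first.
    rewrite -(inv_lim_proj_map ij) -rmorphM -(rmorph1 (inv_map ij)) -rmorphB.
    by rewrite -rmorphXn -rmorphM jn rmorph0.
  by rewrite /drazin_inverse -(inv_lim_proj_map ij) -!rmorphM jx1 jx2.
exists y.
  split; apply: inv_lim_proj_inj => i; rewrite !rmorphM /= !yx; by have [[]] := xP i.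
move=> i; have [_ [n xn]] := xP i; exists n.
by rewrite rmorphM rmorphXn rmorphB rmorph1 rmorphM /= yx.
Qed.

End InverseLimitRing.

Section KernelIdeal.
Variables (R S : pzRingType) (f : {rmorphism R -> S}).

Lemma kernel_right : right_ideal [set x | f x = 0].
Proof.
split=> [|x y /= fx fy|x r /= fx] /=; first exact: rmorph0.
  by rewrite rmorphD fx fy addr0.
by rewrite rmorphM fx mul0r.
Qed.

Lemma kernel_left r x : [set x | f x = 0] x -> [set x | f x = 0] (r * x).
Proof. by rewrite /= rmorphM => ->; rewrite mulr0. Qed.

Definition kernel : ideal R := Ideal kernel_right kernel_left.

End KernelIdeal.

(** * Translation of neighbourhoods *)

Section TopologicalRing.
Variable R : topologicalPzRingType.

Lemma nbhs_translate (x : R) (U : set R) : nbhs x U -> nbhs 0 [set z | U (x + z)].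
Proof.
move=> xU; have cx : (fun z : R => (x, z) : R * R) @ (0 : R) --> (x, 0 : R).
  by apply: cvg_pair => /=; [exact: cvg_cst|exact: cvg_id].
have := @add_continuous R (x, 0) U; rewrite /= addr0 => /(_ xU).
exact: cx.
Qed.

Lemma nbhs_sub (x : R) (U : set R) : nbhs (0 : R) U -> \forall y \near x, U (y - x).
Proof.
move=> U0; have cx : (fun z : R => (z, x) : R * R) @ (x : R) --> (x, x).
  by apply: cvg_pair => /=; [exact: cvg_id|exact: cvg_cst].
have := @sub_continuous R (x, x) U; rewrite /= subrr => /(_ U0).
exact: cx.
Qed.

End TopologicalRing.

(** * The completion at the powers of the Jacobson radical *)

Section JacobsonCompletion.
Variable R : topologicalPzRingType.
Let J n := ideal_exp (jacobson R) n.

Lemma jacobson_completion_projE n (x y : R) :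
  inv_lim_proj (S := jacobson_system R) n (jacobson_completion x) =
  inv_lim_proj (S := jacobson_system R) n (jacobson_completion y) <->
  ideal_set (J n) (x - y).
Proof. exact: quot_projE. Qed.

Lemma jacobson_completion_bij :
  (forall x, (forall n, ideal_set (J n) x) -> x = 0) ->
  (forall s : nat -> R, (forall n, ideal_set (J n) (s n.+1 - s n)) ->
    exists y, forall n, ideal_set (J n) (y - s n)) ->
  bijective (@jacobson_completion R).
Proof.
move=> sepJ complJ.
have surj (z : inv_lim (jacobson_system R)) : exists x, jacobson_completion x = z.
  pose s n : R := repr (inv_lim_proj (S := jacobson_system R) n z : ideal_quot (J n)).
  have zs n : inv_lim_proj n z = quot_proj (J n) (s n) by rewrite quot_projK.
  have [n|y yP] := complJ s.
    apply/quot_projE.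
    rewrite -[RHS]zs -(@inv_lim_proj_map (jacobson_system R) n n.+1 (leqnSn n) z).
    by rewrite (zs n.+1) /= quot_mapE.
  by exists y; apply: inv_lim_proj_inj => n; rewrite zs; exact/quot_projE/yP.
have [g gK] := choice surj; exists g => // x.
apply/subr0_eq/sepJ => n; apply/jacobson_completion_projE.
by rewrite gK.
Qed.

(** Projections of the limit are locally constant, and points with equal projection at level [n]
    come from elements congruent modulo [J n], a basic neighbourhood of 0. *)
Lemma jacobson_completion_iso : has_jacobson_topology R ->
  bijective (@jacobson_completion R) -> topological_ring_iso (@jacobson_completion R).
Proof.
move=> topJ [g fK gK]; split.
  move=> x; apply: inv_lim_cvg => n.
  have : nbhs (0 : R) (J n) by rewrite topJ; exists n.
  by move=> /(nbhs_sub x); apply: filterS => y /jacobson_completion_projE.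
exists g; split=> // z U /nbhs_translate; rewrite topJ => -[n _ JU].
rewrite /nbhs /=; apply: filterS (inv_lim_proj_nbhs (S := jacobson_system R) n z) => w.
rewrite -{1}(gK w) -{1}(gK z) => /jacobson_completion_projE/JU /=.
by rewrite addrC subrK.
Qed.

End JacobsonCompletion.

(** * Transfer of the algebraic results to the topological ring *)

Theorem corollary9p10 (R : topologicalPzRingType) :
  right_noetherian R -> pro pi_regular R ->
  [/\ has_jacobson_topology R,
      strictly_pro right_artinian R,
      (forall I : set R, right_ideal I -> closed I) &
      complete_semilocal R].
Proof.
move=> nR [S [f [[fc [g [fK gK gc]]] piS]]].
pose K i := kernel (@inv_lim_proj S i \o f).
have KE i x : ideal_set (K i) x <-> inv_lim_proj i (f x) = 0 by [].
have K_mono i j : inv_le i j -> K j `<=` K i.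
  by move=> ij x; rewrite !KE -(inv_lim_proj_map ij) => ->; rewrite rmorph0.
have f_inj := can_inj fK.
have K_inh : exists i : inv_index S, True := inv_inhabited S.
have K_dir i j : exists k, K k `<=` K i /\ K k `<=` K j.
  by have [k [ik jk]] := inv_directed i j; exists k; split; exact: K_mono.
have K_sep x : (forall i, ideal_set (K i) x) -> x = 0.
  by move=> Kx; apply: f_inj; apply: inv_lim_proj_inj => i; rewrite !rmorph0; exact: Kx.
have K_compl (x : inv_index S -> R) :
    (forall i j, K j `<=` K i -> ideal_set (K i) (x i - x j)) ->
    exists y, forall i, ideal_set (K i) (y - x i).
  move=> xP.
  have [i j ij|y yE] := @inv_lim_of_compatible S (fun i => inv_lim_proj i (f (x i))).
    rewrite inv_lim_proj_map; apply/esym/subr0_eq; rewrite -!rmorphB.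
    exact/KE/xP/K_mono.
  by exists (g y) => i; apply/KE; rewrite !rmorphB gK /= yE subrr.
have K_drazin a : exists2 x, drazin_inverse a x &
    forall i, exists n, ideal_set (K i) (a ^+ n * (1 - a * x)).
  have [x [ax xax] nx] := inv_lim_drazin (f a) piS; exists (g x).
    by split; apply: f_inj; rewrite !rmorphM gK.
  move=> i; have [n xn] := nx i; exists n; apply/KE.
  by rewrite rmorphM rmorphXn rmorphB rmorph1 rmorphM /= gK.
(* With [nbhsK] below, this makes the [K i] a basis of neighbourhoods of 0. *)
have K_open i : nbhs (0 : R) (K i).
  have := fc 0 [set z | inv_lim_proj i z = 0]; rewrite rmorph0; apply.
  by have := inv_lim_proj_nbhs i (0 : inv_lim S); rewrite rmorph0.
have nbhsK (U : set R) : nbhs (0 : R) U -> exists i, K i `<=` U.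
  move=> U0; have /inv_lim_nbhs0[i iU] : nbhs (0 : inv_lim S) (g @^-1` U).
    by apply: gc; rewrite -(rmorph0 f) fK.
  by exists i => x /KE/iU; rewrite /preimage /= fK.
have topJ : has_jacobson_topology R.
  apply/seteqP; split=> [U /nbhsK[i KU]|U [n _ JU]].
    have [n JK] := jacobson_exp_sub nR K_drazin i.
    by exists n => //; exact: subset_trans KU.
  have [i KJ] := jacobson_exp_open nR K_inh K_dir K_sep K_compl K_drazin n.
  by apply: filterS (K_open i); exact: subset_trans JU.
have bij : bijective (@jacobson_completion R).
  apply: jacobson_completion_bij.
    exact: jacobson_exp_separated nR K_sep K_drazin.
  exact: jacobson_exp_complete nR K_inh K_dir K_sep K_compl K_drazin.
split=> //.
(* The given system may have projections that are not onto, so the quotients R/J^n replace it. *)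
- exists (jacobson_system R), (@jacobson_completion R); split.
  + exact: jacobson_completion_iso.
  + exact: quot_jacobson_exp_artinian nR K_sep K_drazin.
  + by move=> n y; exists (repr y); exact: quot_projK.
- move=> I rI x xI.
  apply: (right_ideal_adically_closed nR K_inh K_dir K_sep K_compl K_drazin rI) => i.
  (* The coset of [K i] at [x] is a neighbourhood of [x], so it meets [I]. *)
  have [a [Ia Ka]] := xI _ (nbhs_sub x (K_open i)).
  exists a => //; rewrite -opprB -mulrN1.
  by have [_ _] := ideal_right (K i); apply.
- split=> //.
  + exact: quot_jacobson_semisimple nR K_sep K_drazin.
  + exact: quot_jacobson_artinian nR K_sep K_drazin.
Qed.
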